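(* Let $u_n$ ($n\ge1$) be the number of rows with the value ''unknown'' in the Kleene truth tables of all bracketed formulae with $n$ distinct propositions $p_1,\dots,p_n$ connected by the binary connective of implication, let $g_n$ be the total number of rows in all these truth tables, and let $C_n=\frac1n\binom{2n-2}{n-1}$. Then $u_1=1$ and, for all $n\ge2$, $$u_n=\sum_{i=1}^{n-1}u_i\,g_{n-i}=\sum_{i=1}^{n-1}u_i\,3^{n-i}C_{n-i}.$$ Moreover the generating function $U(x)=\sum_{n\ge1}u_nx^n$ is $$U(x)=\frac{1-\sqrt{1-12x}}{6}.$$
   Context: Truth values are $1$ (true), $0$ (false), $2$ (unknown). The Kleene implication on $\{0,1,2\}$ is: $1\Rightarrow 1=1$, $1\Rightarrow 0=0$, $1\Rightarrow 2=2$; $0\Rightarrow b=1$ for every $b$; $2\Rightarrow 1=1$, $2\Rightarrow 0=2$, $2\Rightarrow 2=2$. A bracketed formula with $n$ distinct variables is a formula obtained from $p_1\Rightarrow p_2\Rightarrow\cdots\Rightarrow p_n$ by a complete bracketing (equivalently, a full binary tree with $n$ leaves labelled $p_1,\dots,p_n$ from left to right and every internal node labelled $\Rightarrow$); for $n=1$ the only one is $p_1$. A row of the truth table of such a formula is an assignment of $\{0,1,2\}$-values to $p_1,\dots,p_n$, and its value is the value of the formula under this assignment. Counting rows in all truth tables means counting pairs (bracketed formula, assignment). Generating functions are read as formal power series (equivalently, analytic functions near $0$), with $\sqrt{1-12x}$ the square root having constant term $1$. *)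

(* Defs.v *)
From HB Require Import structures.
From mathcomp Require Import all_boot.

Set Implicit Arguments.
Unset Strict Implicit.
Unset Printing Implicit Defensive.

(* [Some true], [Some false] and [None] are the truth values 1, 0 and 2. *)
Definition kleene := option bool.
Definition unknown : kleene := None.

Definition kimp (a b : kleene) : kleene :=
  match a, b with
  | Some true, _ => b
  | Some false, _ => Some true
  | None, Some true => Some true
  | None, Some false => None
  | None, None => None
  end.

(* [Var i], with [i : 'I_n], is the proposition p_{i+1}. *)
Inductive formula (n : nat) := Var of 'I_n | Imp of formula n & formula n.

Fixpoint leaves n (f : formula n) : seq 'I_n :=
  match f with
  | Var i => [:: i]
  | Imp f1 f2 => leaves f1 ++ leaves f2
  end.

Fixpoint eval n (v : {ffun 'I_n -> kleene}) (f : formula n) : kleene :=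
  match f with
  | Var i => v i
  | Imp f1 f2 => kimp (eval v f1) (eval v f2)
  end.

Section FormulaCount.
Variable n : nat.

Fixpoint formula_encode (f : formula n) : GenTree.tree 'I_n :=
  match f with
  | Var i => GenTree.Leaf i
  | Imp f1 f2 => GenTree.Node 0 [:: formula_encode f1; formula_encode f2]
  end.

Fixpoint formula_decode (t : GenTree.tree 'I_n) : option (formula n) :=
  match t with
  | GenTree.Leaf i => Some (Var i)
  | GenTree.Node _ [:: t1; t2] =>
      if (formula_decode t1, formula_decode t2) is (Some f1, Some f2)
      then Some (Imp f1 f2) else None
  | _ => None
  end.

Lemma formula_encodeK : pcancel formula_encode formula_decode.
Proof. by elim=> //= f1 -> f2 ->. Qed.

HB.instance Definition _ := Countable.copy (formula n) (pcan_type formula_encodeK).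
End FormulaCount.

(* The complete bracketings of p_1 => ... => p_n: the leaves, read from left
   to right, are exactly p_1, ..., p_n. There is none for [n = 0]. *)
Record bracketed (n : nat) :=
  Bracketed { bformula :> formula n; _ : leaves bformula == enum 'I_n }.

HB.instance Definition _ n := [isSub for @bformula n].
HB.instance Definition _ n := [Countable of bracketed n by <:].

Fixpoint formulas_upto n (k : nat) : seq (formula n) :=
  if k is k'.+1 then
    [seq Var i | i <- enum 'I_n] ++
    [seq Imp f1 f2 | f1 <- formulas_upto n k', f2 <- formulas_upto n k']
  else [::].

Lemma leaves_gt0 n (f : formula n) : 0 < size (leaves f).
Proof. by elim: f => //= f1 H1 f2 _; rewrite size_cat ltn_addr. Qed.

Lemma mem_formulas_upto n k (f : formula n) :
  size (leaves f) <= k -> f \in formulas_upto n k.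
Proof.
elim: k f => [|k IHk] [i|f1 f2] //=.
- by rewrite leqNgt (leaves_gt0 (Imp f1 f2)).
- by move=> _; rewrite mem_cat map_f // mem_enum.
rewrite size_cat => le_k; rewrite mem_cat; apply/orP; right.
have := leaves_gt0 f1; have := leaves_gt0 f2 => gt2 gt1.
apply/allpairsP; exists (f1, f2); split => //=; apply: IHk; rewrite -ltnS.
- by apply: leq_trans le_k; rewrite -addn1 leq_add2l.
- by apply: leq_trans le_k; rewrite -add1n leq_add2r.
Qed.

Definition bracketed_enum n : seq (bracketed n) :=
  undup (pmap insub (formulas_upto n n)).

Lemma bracketed_enumP n : Finite.axiom (bracketed_enum n).
Proof.
apply: Finite.uniq_enumP; first exact: undup_uniq.
move=> f; rewrite mem_undup mem_pmap_sub mem_formulas_upto //.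
by case: f => f /= /eqP->; rewrite size_enum_ord.
Qed.

HB.instance Definition _ n := isFinite.Build (bracketed n) (@bracketed_enumP n).

Definition row n := (bracketed n * {ffun 'I_n -> kleene})%type.

Definition total_rows (n : nat) : nat := #|{: row n}|.

Definition unknown_rows (n : nat) : nat :=
  #|[set r : row n | eval r.2 r.1 == unknown]|.

(* The division is exact for n >= 1. *)
Definition catalan (n : nat) : nat := 'C(2 * n - 2, n - 1) %/ n.

(* Main.v *)
(* A row with n propositions is a binary tree with n leaves carrying truth
   values, so splitting at the root gives g_n = sum g_i g_(n-i). The value is
   unknown iff (a, b) is (1, 2), (2, 0) or (2, 2); by the symmetry of the
   convolution the pairs (1, 2) may be traded for (2, 1), which gives
   u_n = sum u_i g_(n-i). It follows that g_n = 3 u_n, so U = x + 3 U^2 near 0;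
   the root of this quadratic is selected by U(0) = 0 and continuity.
   The closed form g_n = 3^n C_n reduces to Segner's recurrence for C_n, derived
   from (n+1) C_(n+1) = (4n-2) C_n. *)
From HB Require Import structures.
Require Import Defs.
From Stdlib Require Import Reals Lra Lia.
From Coquelicot Require Import Coquelicot.
From mathcomp Require Import all_boot zify.

Set Implicit Arguments.
Unset Strict Implicit.
Unset Printing Implicit Defensive.

Local Open Scope nat_scope.

(** * Rows as binary trees with truth values at the leaves *)

(* A row (bracketing, assignment) is encoded by the tree obtained by writing at
   each leaf the value of its proposition. *)
Inductive vtree := VLeaf of kleene | VNode of vtree & vtree.

Fixpoint vtree_encode (t : vtree) : GenTree.tree kleene :=
  match t with
  | VLeaf a => GenTree.Leaf a
  | VNode t1 t2 => GenTree.Node 0 [:: vtree_encode t1; vtree_encode t2]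
  end.

Fixpoint vtree_decode (t : GenTree.tree kleene) : option vtree :=
  match t with
  | GenTree.Leaf a => Some (VLeaf a)
  | GenTree.Node _ [:: t1; t2] =>
      if (vtree_decode t1, vtree_decode t2) is (Some u1, Some u2)
      then Some (VNode u1 u2) else None
  | _ => None
  end.

Lemma vtree_encodeK : pcancel vtree_encode vtree_decode.
Proof. by elim=> //= t1 -> t2 ->. Qed.

HB.instance Definition _ := Equality.copy vtree (pcan_type vtree_encodeK).

Fixpoint vleaves (t : vtree) : seq kleene :=
  match t with
  | VLeaf a => [:: a]
  | VNode t1 t2 => vleaves t1 ++ vleaves t2
  end.

Fixpoint veval (t : vtree) : kleene :=
  match t with
  | VLeaf a => a
  | VNode t1 t2 => kimp (veval t1) (veval t2)
  end.

Lemma vleaves_gt0 t : 0 < size (vleaves t).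
Proof. by elim: t => //= t1 H1 t2 _; rewrite size_cat ltn_addr. Qed.

Fixpoint fill n (v : {ffun 'I_n -> kleene}) (f : formula n) : vtree :=
  match f with
  | Defs.Var i => VLeaf (v i)
  | Imp f1 f2 => VNode (fill v f1) (fill v f2)
  end.

Lemma veval_fill n (v : {ffun 'I_n -> kleene}) f : veval (fill v f) = eval v f.
Proof. by elim: f => //= f1 -> f2 ->. Qed.

Lemma vleaves_fill n (v : {ffun 'I_n -> kleene}) f :
  vleaves (fill v f) = map v (leaves f).
Proof. by elim: f => //= f1 -> f2 ->; rewrite map_cat. Qed.

(** As [v] may repeat values, the filled trees give only the shape and the leaf sequence gives the
    variables; equal left shapes cut that sequence at the same place. *)
Lemma fill_inj n (v : {ffun 'I_n -> kleene}) f1 f2 :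
  leaves f1 = leaves f2 -> fill v f1 = fill v f2 -> f1 = f2.
Proof.
elim: f1 f2 => [i|f IHf g IHg] [j|f' g'] //=; first by case=> ->.
move=> Hl [Hf Hg].
have sz : size (leaves f) = size (leaves f').
  by rewrite -(size_map v) -vleaves_fill Hf vleaves_fill size_map.
move/eqP: Hl; rewrite eqseq_cat // => /andP[/eqP Lf /eqP Lg].
by rewrite (IHf _ Lf Hf) (IHg _ Lg Hg).
Qed.

Lemma fill_surj n (v : {ffun 'I_n -> kleene}) t s :
  vleaves t = map v s -> exists2 f, leaves f = s & fill v f = t.
Proof.
elim: t s => [a|t1 IH1 t2 IH2] s /=.
  by case: s => [|i [|]] //= [->]; exists (Defs.Var i).
move=> Hs; set m := size (vleaves t1).
have H1 : vleaves t1 = map v (take m s).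
  by rewrite map_take -Hs take_size_cat.
have H2 : vleaves t2 = map v (drop m s).
  by rewrite map_drop -Hs drop_size_cat.
have [f1 L1 F1] := IH1 _ H1; have [f2 L2 F2] := IH2 _ H2.
by exists (Imp f1 f2); rewrite /= ?L1 ?L2 ?F1 ?F2 ?cat_take_drop.
Qed.

Definition row_tree n (r : row n) : vtree := fill r.2 r.1.

(** The leaves of a bracketing are [enum 'I_n], so the leaf values of the tree recover the
    assignment; [fill_inj] then recovers the formula. *)
Lemma row_tree_inj n : injective (@row_tree n).
Proof.
move=> [[f Lf] v] [[g Lg] w]; rewrite /row_tree /= => Efg.
have Evw : v = w.
  apply/ffunP => i.
  have := congr1 vleaves Efg; rewrite !vleaves_fill (eqP Lf) (eqP Lg).
  by move/eq_in_map => -> //; rewrite mem_enum.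
rewrite -{}Evw in Efg *; congr pair; apply: val_inj => /=.
by apply: fill_inj Efg; rewrite (eqP Lf) (eqP Lg).
Qed.

Definition row_trees n : seq vtree := [seq row_tree r | r : row n].

Lemma row_trees_uniq n : uniq (row_trees n).
Proof. by rewrite map_inj_uniq ?enum_uniq //; exact: row_tree_inj. Qed.

Lemma mem_row_trees n t : (t \in row_trees n) = (size (vleaves t) == n).
Proof.
apply/imageP/eqP => [[[[f Lf] v] _ ->]|sz_t].
  by rewrite /row_tree /= vleaves_fill (eqP Lf) size_map size_enum_ord.
(* Variable [i] takes the leaf value at position [i]; the default is never reached, since [t] has
   [n] leaves. *)
pose v := [ffun i : 'I_n => nth unknown (vleaves t) i].
have Ht : vleaves t = map v (enum 'I_n).
  apply: (@eq_from_nth _ unknown); first by rewrite size_map size_enum_ord.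
  move=> i; rewrite sz_t => lt_i.
  rewrite (nth_map (Ordinal lt_i)) ?size_enum_ord // ffunE.
  by rewrite -[i in RHS]/(val (Ordinal lt_i)) nth_ord_enum.
have [f /eqP Lf <-] := fill_surj Ht.
by exists (Bracketed Lf, v).
Qed.

(** * Splitting at the root and the recurrences *)

Lemma row_trees_split n : 1 < n ->
  perm_eq (row_trees n)
    [seq VNode p.1 p.2 | i <- index_iota 1 n,
       p <- [seq (t1, t2) | t1 <- row_trees i, t2 <- row_trees (n - i)]].
Proof.
move=> n_gt1; apply: uniq_perm.
- exact: row_trees_uniq.
- apply: allpairs_uniq_dep; first exact: iota_uniq.
    move=> i _; apply: allpairs_uniq; try exact: row_trees_uniq.
    by move=> [? ?] [? ?] _ _ [-> ->].
  (* The index [i] is the number of leaves of the left subtree, so equal nodes come from equal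
     indices. *)
  move=> x y /allpairsPdep[i [[a b] [_ /allpairsP[[a' b'] /= [Ha _ Hp] ->]]]].
  move=> /allpairsPdep[j [[c d] [_ /allpairsP[[c' d'] /= [Hc _ Hq] ->]]]] /=.
  case: Hp Hq => -> -> [-> ->] [Eac Ebd].
  move: Ha Hc; rewrite !mem_row_trees Eac => /eqP -> /eqP ->.
  by rewrite Ebd.
move=> t; rewrite mem_row_trees; apply/eqP/allpairsPdep.
  case: t => [a|t1 t2] /= sz_t; first by move: n_gt1; rewrite -sz_t.
  rewrite size_cat in sz_t; exists (size (vleaves t1)), (t1, t2).
  have := vleaves_gt0 t1; have := vleaves_gt0 t2 => gt2 gt1.
  split=> //; first by rewrite mem_index_iota gt1 -sz_t; lia.
  by apply/allpairsP; exists (t1, t2); rewrite !mem_row_trees; split=> //=; lia.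
move=> [i [p [Hi /allpairsP[[t1 t2] [/= H1 H2 ->]] ->]]] /=.
move: Hi H1 H2; rewrite mem_index_iota !mem_row_trees size_cat.
by move=> Hi /eqP-> /eqP->; lia.
Qed.

Lemma big_row_trees_split n (F : vtree -> nat) : 1 < n ->
  \sum_(t <- row_trees n) F t =
  \sum_(1 <= i < n) \sum_(t1 <- row_trees i) \sum_(t2 <- row_trees (n - i))
    F (VNode t1 t2).
Proof.
move=> n_gt1; rewrite (perm_big _ (row_trees_split n_gt1)) big_allpairs_dep /=.
by apply: eq_bigr => i _; rewrite big_allpairs_dep.
Qed.

Definition value_rows (w : kleene) (n : nat) : nat :=
  \sum_(t <- row_trees n) (veval t == w).

Lemma unknown_rowsE n : unknown_rows n = value_rows unknown n.
Proof.
rewrite /unknown_rows /value_rows big_map -sum1dep_card big_mkcond big_enum /=.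
by apply: eq_bigr => r _; rewrite veval_fill; case: eqP.
Qed.

Lemma total_rowsE n : total_rows n = \sum_(t <- row_trees n) 1.
Proof. by rewrite sum1_size size_map -cardE. Qed.

Lemma total_rows_split n : 1 < n ->
  total_rows n = \sum_(1 <= i < n) total_rows i * total_rows (n - i).
Proof.
move=> n_gt1; rewrite total_rowsE big_row_trees_split //.
apply: eq_bigr => i _; rewrite !total_rowsE big_distrl /=.
by apply: eq_bigr => t1 _; rewrite mul1n.
Qed.

Lemma sum_conv_sym n (f g : nat -> nat) :
  \sum_(1 <= i < n) f i * g (n - i) = \sum_(1 <= i < n) g i * f (n - i).
Proof.
rewrite big_nat_rev; apply: eq_big_nat => i /andP[i_gt0 lt_in].
by rewrite mulnC; congr (g _ * f _); lia.
Qed.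

(* The surplus terms on the two sides are exchanged by reversing the
   convolution, hence cancel in [unknown_rows_split]. *)
Lemma unknown_kimp (a b : kleene) :
  (kimp a b == unknown) + (a == unknown) * (b == Some true) =
  (a == unknown) + (a == Some true) * (b == unknown).
Proof. by move: a b => [[]|] [[]|]. Qed.

Lemma unknown_rows_split n : 1 < n ->
  unknown_rows n = \sum_(1 <= i < n) unknown_rows i * total_rows (n - i).
Proof.
move=> n_gt1.
pose T := value_rows (Some true); pose U := value_rows unknown.
have eqS : unknown_rows n + \sum_(1 <= i < n) U i * T (n - i) =
    \sum_(1 <= i < n) U i * total_rows (n - i) +
    \sum_(1 <= i < n) T i * U (n - i).
  rewrite unknown_rowsE /value_rows big_row_trees_split // -!big_split /=.
  apply: eq_bigr => i _; rewrite total_rowsE /U /T /value_rows !big_distrl /=.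
  rewrite -!big_split /=; apply: eq_bigr => t1 _; rewrite !big_distrr /=.
  rewrite -!big_split /=; apply: eq_bigr => t2 _.
  by rewrite muln1 unknown_kimp.
apply/eqP; rewrite -(eqn_add2r (\sum_(1 <= i < n) U i * T (n - i))) eqS.
rewrite (sum_conv_sym _ T) eqn_add2r; apply/eqP.
by apply: eq_bigr => i _; rewrite unknown_rowsE.
Qed.

Lemma row_trees1 : perm_eq (row_trees 1) [seq VLeaf a | a : kleene].
Proof.
apply: uniq_perm; first exact: row_trees_uniq.
  by rewrite map_inj_uniq ?enum_uniq // => a b [].
move=> t; rewrite mem_row_trees; apply/eqP/imageP => [|[a _ ->]] //.
case: t => [a _|t1 t2] /=; first by exists a.
have := vleaves_gt0 t1; have := vleaves_gt0 t2.
by rewrite size_cat; lia.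
Qed.

Lemma total_rows1 : total_rows 1 = 3.
Proof.
rewrite total_rowsE sum1_size (perm_size row_trees1) size_map -cardE.
by rewrite card_option card_bool.
Qed.

Lemma unknown_rows1 : unknown_rows 1 = 1.
Proof.
rewrite unknown_rowsE /value_rows (perm_big _ row_trees1) big_map big_enum /=.
by rewrite (bigD1 unknown) //= big1 // => a /negbTE ->.
Qed.

Lemma unknown_rows0 : unknown_rows 0 = 0.
Proof.
rewrite unknown_rowsE /value_rows big1_seq // => t.
rewrite mem_row_trees => /andP[_ /eqP sz_t].
by have := vleaves_gt0 t; rewrite sz_t.
Qed.

(** Both sequences satisfy the same linear recurrence x_n = sum x_i g_(n-i), with initial values 3
    and 1. *)
Lemma total_rows_unknown n : 0 < n -> total_rows n = 3 * unknown_rows n.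
Proof.
elim/ltn_ind: n => -[|[|n]] // IHn _.
  by rewrite total_rows1 unknown_rows1.
rewrite total_rows_split // unknown_rows_split // big_distrr /=.
apply: eq_big_nat => i /andP[i_gt0 lt_in].
by rewrite mulnA IHn.
Qed.

(** * Catalan numbers and Segner's recurrence *)

Lemma catalan_mul n : 0 < n -> n * catalan n = 'C(2 * n - 2, n - 1).
Proof.
case: n => // n _.
rewrite /catalan mulnC divnK //.
have -> : 2 * n.+1 - 2 = n.*2 by lia.
rewrite subn1 /=.
have := mul_bin_left n.*2 n.
have -> : n.*2 - n = n by lia.
(* Exactness of the division: (n+1) C(2n, n+1) = n C(2n, n) exhibits the quotient as C(2n, n) -
   C(2n, n+1). *)
move=> E; suff -> : 'C(n.*2, n) = n.+1 * ('C(n.*2, n) - 'C(n.*2, n.+1)).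
  exact: dvdn_mulr.
rewrite mulnBr E mulSn; lia.
Qed.

Lemma catalan_rec n : 0 < n -> n.+1 * catalan n.+1 = (4 * n - 2) * catalan n.
Proof.
case: n => // n _.
(* The factor n+1 turns both sides into central binomials: (n+1) C(2n+2, n+1) = (4n+2) C(2n, n). *)
apply/eqP; rewrite -(eqn_pmul2l (ltn0Sn n)) [X in _ == X]mulnCA !catalan_mul //.
have -> : 2 * n.+2 - 2 = n.*2.+2 by lia.
have -> : 2 * n.+1 - 2 = n.*2 by lia.
rewrite !subn1 /=.
have A := mul_bin_diag n.*2.+1 n.
have -> : 4 * n.+1 - 2 = 2 * n.*2.+1 by lia.
have sym : 'C(n.*2.+1, n) = 'C(n.*2.+1, n.+1).
  by rewrite -bin_sub; [congr 'C(_, _); lia | lia].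
rewrite binS sym; apply/eqP.
by rewrite -mulnA A; lia.
Qed.

(** Reversal turns the weight i into n - i, and the two weights add up to n. *)
Lemma sum_weighted_conv n (f : nat -> nat) :
  2 * (\sum_(1 <= i < n) i * f i * f (n - i)) =
  n * (\sum_(1 <= i < n) f i * f (n - i)).
Proof.
rewrite mul2n -addnn {2}(sum_conv_sym n (fun i => i * f i)) -big_split /=.
rewrite big_distrr /=; apply: eq_big_nat => i /andP[i_gt0 lt_in].
have := subnKC (ltnW lt_in); move: (n - i) => m <-; nia.
Qed.

(* The weight [i] lets [catalan_rec] be applied under the sum; by symmetry of
   the convolution it averages out to half of the total index. *)
Lemma catalan_conv n : 1 < n ->
  catalan n = \sum_(1 <= i < n) catalan i * catalan (n - i).
Proof.
case: n => [|[|n]] // _; elim: n => [|n IHn]; first by rewrite big_nat1.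
set S := (X in catalan n.+2 = X) in IHn.
set S' := (X in _ = X).
have W' := sum_weighted_conv n.+3 catalan.
have W := sum_weighted_conv n.+2 catalan.
rewrite -/S' big_nat_recl //= [catalan 1]/= !mul1n subn1 /= in W'.
rewrite -/S in W.
set A := (X in 2 * X = _) in W; set A' := (X in _ + X) in W'.
(* [A'] is the weighted sum without its first term, reindexed by one; termwise this is (i+1) C_(i+1)
   + 2 C_i = 4 i C_i. *)
have EA : A' + 2 * S = 4 * A.
  rewrite /A' /S /A !big_distrr -big_split /=.
  apply: eq_big_nat => i /andP[i_gt0 _]; rewrite subSS.
  have := catalan_rec i_gt0; nia.
have R := catalan_rec (ltn0Sn n.+1).
(* With [S] = C_(n+2): (n+3) S' = 2 C_(n+2) + 2 A' = 8 A - 2 S = (4(n+2) - 2) S, which is (n+3)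
   C_(n+3). *)
apply/eqP; rewrite -(eqn_pmul2l (ltn0Sn n.+2)); apply/eqP.
nia.
Qed.

(** * Closed form of g_n and an exponential bound *)

Lemma total_rows_catalan n : 0 < n -> total_rows n = 3 ^ n * catalan n.
Proof.
elim/ltn_ind: n => -[|[|n]] // IHn _; first by rewrite total_rows1.
rewrite total_rows_split // catalan_conv // big_distrr /=.
apply: eq_big_nat => i /andP[i_gt0 lt_in].
rewrite !IHn ?subn_gt0 //; last by lia.
by rewrite mulnACA -expnD subnKC // ltnW.
Qed.

Lemma catalan_le n : 0 < n -> catalan n <= 4 ^ n.
Proof.
elim: n => [|[|n] IHn] // _; rewrite expnS -(leq_pmul2l (ltn0Sn n.+1)).
by rewrite catalan_rec //; have := IHn isT; nia.
Qed.

(** Used to bound the radius of convergence of U from below by 1/12. *)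
Lemma unknown_rows_le n : unknown_rows n <= 12 ^ n.
Proof.
case: n => [|n]; first by rewrite unknown_rows0.
apply: (@leq_trans (total_rows n.+1)); first by rewrite total_rows_unknown //; lia.
rewrite total_rows_catalan // -[12]/(3 * 4) expnMn leq_mul2l.
by rewrite catalan_le ?orbT.
Qed.

(** Puts the recurrence into Cauchy product form: g = 3 u, and the added end terms vanish because
    u_0 = 0. *)
Lemma unknown_rows_conv n : 1 < n ->
  unknown_rows n = 3 * \sum_(i < n.+1) unknown_rows i * unknown_rows (n - i).
Proof.
move=> n_gt1; rewrite unknown_rows_split // 
  -(big_mkord xpredT (fun i => unknown_rows i * unknown_rows (n - i))%N) /=.
case: n n_gt1 => // n n_gt0.
rewrite [X in 3 * X]big_nat_recl // [X in 3 * (_ + X)]big_nat_recr // unknown_rows0 subnn unknown_rows0 /=.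
rewrite muln0 addn0 add0n big_add1 big_distrr /=.
apply: eq_big_nat => i lt_in.
by rewrite total_rows_unknown ?subn_gt0 ?ltnS; lia.
Qed.

(** * The generating function *)

Local Open Scope R_scope.

Lemma INR_sum_ord (F : nat -> nat) n :
  INR (\sum_(i < n.+1) F i) = sum_f_R0 (fun i => INR (F i)) n.
Proof.
elim: n => [|n IHn]; first by rewrite big_ord1.
by rewrite big_ord_recr /= plus_INR IHn.
Qed.

Definition unknown_rowsR (n : nat) : R := INR (unknown_rows n).
Local Notation u := unknown_rowsR.

Lemma CV_radius_unknown_rows : Rbar_le (/ 12) (CV_radius u).
Proof.
have [ub _] := CV_radius_bounded u; apply: ub; exists 1 => n.
have le_u : u n <= 12 ^ n.
  have := le_INR _ _ (elimT leP (unknown_rows_le n)).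
  suff -> : INR (12 ^ n) = (12 ^ n)%R by [].
  elim: n => //= n IHn; rewrite expnS mult_INR IHn; congr (_ * _) => /=; lra.
have u_ge0 : 0 <= u n := pos_INR _.
have p : 0 < 12 ^ n by apply: pow_lt; lra.
rewrite pow_inv Rabs_pos_eq.
  by apply: (Rmult_le_reg_r (12 ^ n)) => //; rewrite Rmult_assoc Rinv_l; lra.
by apply: Rmult_le_pos => //; apply/Rlt_le/Rinv_0_lt_compat.
Qed.

Lemma unknown_rows_PS_mult n : u n.+2 = 3 * PS_mult u u n.+2.
Proof.
rewrite {1}/unknown_rowsR unknown_rows_conv // mult_INR.
rewrite (INR_sum_ord (fun i => unknown_rows i * unknown_rows (n.+2 - i))%N).
rewrite (_ : INR 3 = 3); last by rewrite /=; ring.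
by congr (3 * _); apply: PartSum.sum_eq => i _; rewrite mult_INR.
Qed.

Lemma PSeries_unknown_rows x : Rabs x < / 12 ->
  PSeries u x = x + 3 * (PSeries u x * PSeries u x).
Proof.
move=> lt_x.
have in_disk : Rbar_lt (Rabs x) (CV_radius u).
  exact: (Rbar_lt_le_trans _ (/ 12) _ _ CV_radius_unknown_rows).
have ex_decr a : ex_pseries a x -> ex_pseries (PS_decr_1 a) x.
  apply: ex_pseries_decr_1; case: (Req_dec x 0) => [|x0]; [by left|right].
  by exists (/ x); rewrite /mult /= Rinv_l.
have ex_u := CV_radius_inside _ _ in_disk.
have ex_uu := ex_pseries_mult _ _ _ in_disk in_disk.
have u0 : u 0 = 0 by rewrite /unknown_rowsR unknown_rows0.
have u1 : u 1 = 1 by rewrite /unknown_rowsR unknown_rows1.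
(* The coefficient recurrence starts at degree 2, so the coefficients of degree 0 and 1 are split
   off from U and from U^2; those of U^2 vanish as u_0 = 0. *)
rewrite -PSeries_mult // {1}PSeries_decr_1 // PSeries_decr_1; last exact: ex_decr.
rewrite [PSeries (PS_mult _ _) x]PSeries_decr_1 //.
rewrite [PSeries (PS_decr_1 (PS_mult _ _)) x]PSeries_decr_1; last exact: ex_decr.
rewrite /PS_decr_1 u0 u1.
rewrite (PSeries_ext (fun n => u n.+2)
  (PS_scal 3 (fun n => PS_mult u u n.+2))).
  by rewrite PSeries_scal /PS_mult /= u0; ring.
exact: unknown_rows_PS_mult.
Qed.

Lemma is_pseries_unknown_rows :
  locally 0 (fun x => is_pseries u x ((1 - sqrt (1 - 12 * x)) / 6)).
Proof.
have cont : continuous (PSeries u) 0.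
  apply/continuity_pt_filterlim/PSeries_continuity.
  apply: (Rbar_lt_le_trans _ (/ 12) _ _ CV_radius_unknown_rows); rewrite Rabs_R0 /=; lra.
(* This bound keeps 1 - 6 U positive, which selects the root of the quadratic. *)
have small : locally 0 (fun x => PSeries u x < / 6).
  apply: (cont (fun y => y < / 6)); rewrite PSeries_0 /unknown_rowsR unknown_rows0.
  apply: open_lt; rewrite /=; lra.
have disk : locally 0 (fun x => Rabs x < / 12).
  have p : 0 < / 12 by lra.
  exists (mkposreal _ p) => y; rewrite /ball /= /AbsRing_ball /abs /minus /plus /opp /=.
  by rewrite Ropp_0 Rplus_0_r.
apply: filter_imp (filter_and _ _ small disk) => x [lt_W lt_x].
have EW := PSeries_unknown_rows lt_x.
have -> : (1 - sqrt (1 - 12 * x)) / 6 = PSeries u x.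
  (* Completing the square in U = x + 3 U^2. *)
  have -> : 1 - 12 * x = (1 - 6 * PSeries u x) * (1 - 6 * PSeries u x) by lra.
  rewrite sqrt_square; lra.
apply/PSeries_correct/CV_radius_inside.
exact: (Rbar_lt_le_trans _ (/ 12) _ _ CV_radius_unknown_rows).
Qed.

Theorem proposition2 :
  unknown_rows 1 = 1%N /\
  (forall n : nat, (2 <= n)%N ->
     unknown_rows n
       = (\sum_(1 <= i < n) unknown_rows i * total_rows (n - i))%N /\
     unknown_rows n
       = (\sum_(1 <= i < n) unknown_rows i * (3 ^ (n - i) * catalan (n - i)))%N) /\
  locally 0 (fun x : R =>
    is_pseries (fun n : nat => INR (unknown_rows n)) x
      ((1 - sqrt (1 - 12 * x)) / 6)).
Proof.
split; first exact: unknown_rows1.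
split; last exact: is_pseries_unknown_rows.
move=> n n_gt1; split; first exact: unknown_rows_split.
rewrite unknown_rows_split //; apply: eq_big_nat => i /andP[_ lt_in].
by rewrite total_rows_catalan // subn_gt0.
Qed.
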